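(* Let $n\geq 2$, let $A=[a_{ij}]\in\mathcal{PC}_{n}$ be an $n$-by-$n$ reciprocal matrix, and let $w=[w_{1}\ \cdots\ w_{n}]^{T}$ be a positive $n$-vector. Then there are a reciprocal matrix $B\in\mathcal{PC}_{n+1}$ with $B(n+1)=A$ and a real number $w_{n+1}>0$ such that the vector $w'=\begin{bmatrix} w\\ w_{n+1}\end{bmatrix}$ is efficient for $B$. Moreover, $B$ can be chosen so that the corresponding $w_{n+1}$ is arbitrarily small; that is, for every $\varepsilon>0$ there are $B\in\mathcal{PC}_{n+1}$ with $B(n+1)=A$ and $w_{n+1}$ with $0<w_{n+1}<\varepsilon$ such that $w'=\begin{bmatrix} w\\ w_{n+1}\end{bmatrix}$ is efficient for $B$.
   Context: $\mathcal{PC}_{n}$ denotes the set of $n$-by-$n$ reciprocal matrices, i.e. real matrices $A=[a_{ij}]$ with all entries positive and $a_{ji}=1/a_{ij}$ for all $i,j$ (in particular $a_{ii}=1$). A positive $n$-vector is a vector in $\mathbb{R}^{n}$ with all entries positive. For $B\in\mathcal{PC}_{n+1}$, $B(n+1)$ denotes the principal submatrix of $B$ obtained by deleting row and column $n+1$. A positive $m$-vector $w$ is efficient for $A=[a_{ij}]\in\mathcal{PC}_{m}$ if there is no positive $m$-vector $v$ such that $\left|a_{ij}-\frac{v_i}{v_j}\right|\leq\left|a_{ij}-\frac{w_i}{w_j}\right|$ for all $i,j\in\{1,\ldots,m\}$, with strict inequality for at least one pair $(i,j)$. Known fact: let $G_{A,w}$ be the directed graph with vertex set $\{1,\ldots,m\}$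 and an edge $i\rightarrow j$, $i\neq j$, if and only if $w_i\geq a_{ij}w_j$. Then $w$ is efficient for $A$ if and only if $G_{A,w}$ is strongly connected or, equivalently, $G_{A,w}$ has a Hamiltonian cycle. *)

(* Defs.v *)
From mathcomp Require Export all_boot all_order all_algebra.
From mathcomp Require Export reals.

Set Implicit Arguments.
Unset Strict Implicit.
Unset Printing Implicit Defensive.

Import Order.TTheory GRing.Theory Num.Theory.
Local Open Scope ring_scope.

(* The case i = j gives (A i i)^2 = 1, hence A i i = 1 by positivity. *)
Definition reciprocal (R : realType) (n : nat) (A : 'M[R]_n) : Prop :=
  (forall i j, 0 < A i j) /\ (forall i j, A j i = 1 / A i j).

Definition positive_vec (R : realType) (n : nat) (w : 'cV[R]_n) : Prop :=
  forall i, 0 < w i 0.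

(* Efficient vectors are positive by definition. *)
Definition efficient (R : realType) (m : nat) (A : 'M[R]_m) (w : 'cV[R]_m)
    : Prop :=
  positive_vec w /\
  ~ exists v : 'cV[R]_m,
      [/\ positive_vec v,
          forall i j, `|A i j - v i 0 / v j 0| <= `|A i j - w i 0 / w j 0|
        & exists i j, `|A i j - v i 0 / v j 0| < `|A i j - w i 0 / w j 0|].

(* Square matrices of order n + 1 are typed 'M_(n + 1), so that the last index
   is the second block: ulsubmx B deletes the last row and column of B, as the
   following lemma shows, and col_mx w (const_mx x) appends the entry x to w. *)
Lemma ulsubmx_row'_col' (R : realType) (n : nat) (B : 'M[R]_(n + 1)) :
  forall (i j : 'I_(n + 1).-1) (i' j' : 'I_n),
  i = i' :> nat -> j = j' :> nat ->
  row' (rshift n ord0) (col' (rshift n ord0) B) i j = ulsubmx B i' j'.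
Proof.
move=> i j i' j' ei ej; rewrite !mxE; congr (B _ _); apply: val_inj => /=.
  by rewrite /bump ei addn0 leqNgt ltn_ord.
by rewrite /bump ej addn0 leqNgt ltn_ord.
Qed.

(* Main.v *)
Require Import Defs.

Set Implicit Arguments.
Unset Strict Implicit.
Unset Printing Implicit Defensive.

Import Order.TTheory GRing.Theory Num.Theory.
Local Open Scope ring_scope.

(** The new column of [B] may be chosen freely, so for any prescribed [x > 0]
    let it reproduce the ratios [w i / x] exactly.  A vector at least as good
    as [w'] must then also have zero error in the last column, so it has the
    same ratios to its last entry as [w'].  Hence it is proportional to [w']
    and improves no entry of [B] ([efficient_exact_col]).  In terms of the
    digraph of [B] and [w'], the new vertex is joined to every old vertex in
    both directions, which makes the digraph strongly connected whatever [A]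
    is.  Since [x] is arbitrary, it can be taken below any [eps]. *)

(** Zero error in a single column already fixes a competing vector up to
    scaling, because every ratio [v i / v j] is the quotient of the ratios of
    [v i] and [v j] to [v k]. *)
Lemma efficient_exact_col (R : realType) (m : nat) (A : 'M[R]_m)
    (w : 'cV[R]_m) (k : 'I_m) :
  positive_vec w -> (forall i, A i k = w i 0 / w k 0) -> efficient A w.
Proof.
move=> w_gt0 Ak; split=> // -[v [v_gt0 v_le [i [j]]]].
have ratio_k l : v l 0 / v k 0 = w l 0 / w k 0.
  have := v_le l k; rewrite Ak subrr normr0 normr_le0 subr_eq0.
  by move/eqP.
have ratioE (u : 'cV[R]_m) : positive_vec u ->
    u i 0 / u j 0 = (u i 0 / u k 0) / (u j 0 / u k 0).
  by move=> u_gt0; rewrite invf_div mulrA divfK // gt_eqF.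
by rewrite (ratioE v) // (ratioE w) // !ratio_k ltxx.
Qed.

Definition exact_extension (R : realType) (n : nat) (A : 'M[R]_n)
    (w : 'cV[R]_n) (x : R) : 'M[R]_(n + 1) :=
  block_mx A (\col_i (w i 0 / x)) (\row_j (x / w j 0)) (const_mx 1).

Lemma exact_extension_reciprocal (R : realType) (n : nat) (A : 'M[R]_n)
    (w : 'cV[R]_n) (x : R) :
  reciprocal A -> positive_vec w -> 0 < x ->
  reciprocal (exact_extension A w x).
Proof.
move=> [A_gt0 A_inv] w_gt0 x_gt0; split=> i j; rewrite /exact_extension.
  by case: (split_ordP i) => i' ->; case: (split_ordP j) => j' ->;
    rewrite ?(block_mxEul, block_mxEur, block_mxEdl, block_mxEdr) ?mxE
      ?divr_gt0 ?ltr01.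
by case: (split_ordP i) => i' ->; case: (split_ordP j) => j' ->;
  rewrite ?(block_mxEul, block_mxEur, block_mxEdl, block_mxEdr) ?mxE
    ?div1r ?invf_div ?invr1 // A_inv div1r.
Qed.

Lemma exact_extension_efficient (R : realType) (n : nat) (A : 'M[R]_n)
    (w : 'cV[R]_n) (x : R) :
  positive_vec w -> 0 < x ->
  efficient (exact_extension A w x) (col_mx w (const_mx x)).
Proof.
move=> w_gt0 x_gt0; apply: (@efficient_exact_col _ _ _ _ (rshift n ord0)).
  by move=> i; case: (split_ordP i) => i' ->; rewrite ?col_mxEu ?col_mxEd ?mxE.
move=> i; rewrite /exact_extension; case: (split_ordP i) => i' ->.
  by rewrite block_mxEur col_mxEu col_mxEd !mxE.
by rewrite block_mxEdr !col_mxEd !mxE divff // gt_eqF.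
Qed.

Theorem theorem2 (R : realType) (n : nat) (hn : (2 <= n)%N)
    (A : 'M[R]_n) (hA : reciprocal A)
    (w : 'cV[R]_n) (hw : positive_vec w) :
  (exists (B : 'M[R]_(n + 1)) (x : R),
      [/\ reciprocal B, ulsubmx B = A, 0 < x
        & efficient B (col_mx w (const_mx x))]) /\
  (forall eps : R, 0 < eps ->
    exists (B : 'M[R]_(n + 1)) (x : R),
      [/\ reciprocal B, ulsubmx B = A, 0 < x < eps
        & efficient B (col_mx w (const_mx x))]).
Proof.
have ext x : 0 < x -> [/\ reciprocal (exact_extension A w x),
    ulsubmx (exact_extension A w x) = A
    & efficient (exact_extension A w x) (col_mx w (const_mx x))].
  move=> x_gt0; split; first exact: exact_extension_reciprocal.
    exact: block_mxKul.
  exact: exact_extension_efficient.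
split=> [|eps eps_gt0].
  by exists (exact_extension A w 1), 1; case: (ext 1 ltr01); split.
have half_gt0 : 0 < eps / 2 by rewrite divr_gt0 // ltr0n.
exists (exact_extension A w (eps / 2)), (eps / 2).
have [recB subB effB] := ext _ half_gt0; split=> //.
by rewrite half_gt0 ltr_pdivrMr ?ltr0n // ltr_pMr // ltr1n.
Qed.
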